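(* The function $E$ is strictly convex on $\Omega$.
   Context: Data: an integer $m\ge 1$; real numbers $u_0\le u_1<u_2<\cdots<u_m<u_{m+1}=u_D$; constants $a_i>0$, $k_i>0$ ($i=0,\ldots,m$) and $d_i\ge 0$ ($i=1,\ldots,m$), with $d_1>0$ if $u_0=u_1$. Put $F(\xi)=\frac{1}{\sqrt{\pi}}\int_0^\xi e^{-s^2/4}\,ds$, with $F(+\infty)=1$. Let $\Omega=\{\bar\xi=(\xi_1,\ldots,\xi_m)\in\mathbb{R}^m : \xi_1>\cdots>\xi_m>0\}$ (an open convex set) and, with the conventions $\xi_0=+\infty$, $\xi_{m+1}=0$, $$E(\bar\xi)=-\sum_{i=0}^m k_i(u_{i+1}-u_i)\ln\bigl(F(\xi_i/a_i)-F(\xi_{i+1}/a_i)\bigr)+\sum_{i=1}^m \frac{d_i\xi_i^2}{4},\qquad \bar\xi\in\Omega.$$ *)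

(* Defs.v *)
From HB Require Import structures.
From mathcomp Require Import all_boot all_order all_algebra.
From mathcomp Require Import all_classical all_reals all_analysis.

Set Implicit Arguments.
Unset Strict Implicit.
Unset Printing Implicit Defensive.

Import Order.TTheory GRing.Theory Num.Theory.
Import numFieldNormedType.Exports.

Local Open Scope classical_set_scope.
Local Open Scope ring_scope.
Local Open Scope convex_scope.

(* Strict counterpart of the library's [convex_set] and [convex_function];
   [t : {i01 R}] ranges over [0, 1] and [x <| t |> y] is t x + (1 - t) y. *)
Definition strictly_convex_function (R : numFieldType) (V : lmodType R)
    (V' := convex_lmodType V) (D : set V') (f : V' -> R^o) : Prop :=
  convex_set D /\
  forall t : {i01 R}, 0 < t%:num -> t%:num < 1 ->
    {in D &, forall x y : V', x != y -> (f (x <| t |> y) < f x <| t |> f y)%R}.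

(* The oriented integral of exp(-s^2/4) from 0 to x. *)
Definition heat_integral (R : realType) (x : R) : R :=
  if 0 <= x
  then \int[lebesgue_measure]_(s in `[0, x]) expR (- (s ^+ 2 / 4))
  else - \int[lebesgue_measure]_(s in `[x, 0]) expR (- (s ^+ 2 / 4)).

(* The value at -oo is never used; it is the limit of the odd function F. *)
Definition heatF (R : realType) (x : \bar R) : R :=
  match x with
  | r%:E => (Num.sqrt pi)^-1 * heat_integral r
  | +oo%E => 1
  | -oo%E => -1
  end.

(* xi_i in the 1-based indexing of the mathematics, with xi_0 = +oo and
   xi_(m+1) = 0: the coordinate xi_i, 1 <= i <= m, is stored as [xi 0 (i - 1)].
   Indices beyond m + 1 are irrelevant. *)
Definition extxi (R : realType) (m : nat) (xi : 'rV[R]_m) (i : nat) : \bar R :=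
  match i with
  | 0%N => +oo%E
  | j.+1 => if insub j is Some o then (xi 0 (o : 'I_m))%:E else 0%:E
  end.

(* xi_1 > ... > xi_m > xi_(m+1) = 0 *)
Definition Omega (R : realType) (m : nat) : set 'rV[R]_m :=
  [set xi | forall i : nat, (1 <= i <= m)%N ->
    (extxi xi i.+1 < extxi xi i)%E].

(* Only u_0, ..., u_(m+1), a_i and k_i for i <= m, and d_i for 1 <= i <= m
   occur.  Since a_i > 0, the product with (a_i^-1)%:E is division by a_i in
   the extended reals, and sends xi_0 = +oo to +oo. *)
Definition energy (R : realType) (m : nat) (u a k d : nat -> R)
    (xi : 'rV[R]_m) : R :=
  - (\sum_(i < m.+1) k i * (u i.+1 - u i) *
       ln (heatF (extxi xi i * ((a i)^-1)%:E)%E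
           - heatF (extxi xi i.+1 * ((a i)^-1)%:E)%E))
  + \sum_(i < m) d i.+1 * (xi 0 i) ^+ 2 / 4.

(* Main.v *)
Require Import Defs.
From HB Require Import structures.
From mathcomp Require Import all_boot all_order all_algebra.
From mathcomp Require Import all_classical all_reals all_analysis.
From mathcomp Require Import ring lra.
Import Order.TTheory GRing.Theory Num.Theory.
Import numFieldNormedType.Exports.
Local Open Scope classical_set_scope.
Local Open Scope ring_scope.

(** Every summand of the energy is convex: the i-th logarithm depends on the
pair (xi_i, xi_(i+1)) through the Gaussian mass D(x, y) = F(x) - F(y) of an
interval, and such masses are log-concave because exp(-s^2/4) is. Two distinct
points of Omega differ in some coordinate xi_i with 1 <= i <= m, and the
summand that measures the gap F(xi_i/a_i) - F(xi_(i+1)/a_i) is strictly convex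
along the segment joining them and has the positive weight k_i (u_(i+1) - u_i).
That is enough for the whole sum, the remaining summands being convex in the
weak sense.

Strict log-concavity of the gap is checked along a segment, where x and y move
at constant speeds h and k.  With f = F', so that f'(s) = -(s/2) f(s), the
second derivative of ln D has the sign of D D'' - (D')^2, which is minus a
quadratic form in (h, k).  Its determinant is positive exactly when
   D x y < 2 (x f(y) - y f(x)),
which for y > 0 is the Mills-type bound
   F(x) - F(y) < 2 f(y)/y - 2 f(x)/x  ([heatF_gap_lt]).
The latter says that F(s) + 2 f(s)/s decreases, and its derivative is
-2 f(s)/s^2.  The mass 1 - F(y) of the outermost, unbounded interval obeys the
limit of the same bound ([heatF_tail_lt]), where F(x) -> 1 is the value of the
Gauss integral. *)

(** * The error function F and its density *)

(** The integral starts at -oo so that one antiderivative of the Gaussian serves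
on both sides of 0, where the oriented integral changes its formula. *)
Definition gauss_cdf {R : realType} (x : R) : R :=
  \int[lebesgue_measure]_(s in `]-oo, x]) gauss_fun s.

Lemma is_derive_gauss_cdf {R : realType} (x : R) :
  is_derive x 1 (@gauss_cdf R) (gauss_fun x).
Proof.
have [] := @continuous_FTC1 R gauss_fun (BInfty R true) x (x + 1).
- by rewrite ltrDl.
- by apply: integrableS integrableT_gauss.
- by rewrite ltNyr.
- exact: continuous_gauss_fun.
by move=> dF F'; apply: DeriveDef => //; rewrite -derive1E.
Qed.

(** The rescaling s = 2 r turns exp(-r^2) into the heat profile exp(-s^2/4). *)
Lemma is_derive_gauss_cdf_half {R : realType} (x : R) :
  is_derive x 1 (fun s => 2 * gauss_cdf (s / 2)) (expR (- (x ^+ 2 / 4))).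
Proof.
have h : is_derive x 1 (fun s : R => s / 2) 2^-1.
  by apply: is_derive_eq; rewrite /GRing.scale /=; ring.
have := @is_derive1_comp R gauss_cdf (fun s => s / 2) x _ _
  (is_derive_gauss_cdf (x / 2)) h.
move=> dc; have -> : (fun s : R => 2 * gauss_cdf (s / 2)) =
  2 \*: (@gauss_cdf R \o (fun s => s / 2)) by [].
apply: is_derive_eq; rewrite /gauss_fun /GRing.scale /= mulrCA mulfV// mulr1.
by congr expR; field.
Qed.

Lemma Rintegral_FTC2 {R : realType} (f P : R -> R) (a b : R) : a <= b ->
  continuous f -> (forall x : R, is_derive x 1 P (f x)) ->
  \int[lebesgue_measure]_(s in `[a, b]) f s = P b - P a.
Proof.
rewrite le_eqVlt => /predU1P[<- _ _|ab cf dP].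
  by rewrite set_itv1 Rintegral_set1 subrr.
have cP : continuous P.
  move=> x; apply: differentiable_continuous; apply/derivable1_diffP.
  by have [] := dP x.
rewrite /Rintegral (@continuous_FTC2 _ f P)//.
- exact: continuous_subspaceT.
- split=> [x _||]; first by have [] := dP x.
  + by apply: cvg_at_right_filter; exact: cP.
  + by apply: cvg_at_left_filter; exact: cP.
- by move=> x _; rewrite derive1E; have [] := dP x.
Qed.

Lemma continuous_gauss_half {R : realType} :
  continuous (fun s : R => expR (- (s ^+ 2 / 4))).
Proof.
move=> x; have -> : (fun s : R => expR (- (s ^+ 2 / 4))) =
    @gauss_fun R \o (fun s => s / 2).
  by apply/funext => s /=; rewrite /gauss_fun; congr expR; field.
apply: continuous_comp; last exact: continuous_gauss_fun.
by apply: cvgM; [exact: cvg_id|exact: cvg_cst].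
Qed.

Lemma heat_integralE {R : realType} (x : R) :
  heat_integral x = 2 * gauss_cdf (x / 2) - 2 * gauss_cdf 0.
Proof.
have FTC := fun a b ab => @Rintegral_FTC2 R _ _ a b ab
  (@continuous_gauss_half R) (@is_derive_gauss_cdf_half R).
by rewrite /heat_integral; case: lerP => [x0|/ltW x0]; rewrite FTC// mul0r ?opprB.
Qed.

Definition heat_density {R : realType} (x : R) : R :=
  (Num.sqrt pi)^-1 * expR (- (x ^+ 2 / 4)).

Lemma heat_density_gt0 {R : realType} (x : R) : 0 < heat_density x.
Proof. by rewrite mulr_gt0 ?expR_gt0// invr_gt0 sqrtr_gt0 pi_gt0. Qed.

Lemma is_derive_heatF {R : realType} (x : R) :
  is_derive x 1 (fun s => heatF s%:E) (heat_density x).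
Proof.
have -> : (fun s : R => heatF s%:E) =
    (Num.sqrt pi)^-1 \*: ((fun s => 2 * gauss_cdf (s / 2)) - cst (2 * gauss_cdf 0)).
  by apply/funext => s; rewrite /= heat_integralE.
have := is_derive_gauss_cdf_half x => ?.
by apply: is_derive_eq; rewrite subr0.
Qed.

Lemma is_derive_heat_density {R : realType} (x : R) :
  is_derive x 1 (@heat_density R) (- (x / 2) * heat_density x).
Proof.
have h : is_derive x 1 (fun s : R => - (s ^+ 2 / 4)) (- (x / 2)).
  by apply: is_derive_eq; rewrite /GRing.scale /= !(mulr0, add0r, mulr1); field.
have dc := @is_derive1_comp R expR (fun s : R => - (s ^+ 2 / 4)) x _ _
  (is_derive_expR _) h.
have -> : @heat_density R =
  (Num.sqrt pi)^-1 \*: (expR \o (fun s : R => - (s ^+ 2 / 4))) by [].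
apply: is_derive_eq; rewrite /GRing.scale /= /heat_density.
by set e := expR _; rewrite [RHS]mulrCA (mulrC e).
Qed.

(** This is where the normalisation 1 / sqrt pi matters: F(x) is
2 / sqrt pi times the integral of exp(-r^2) over [0, x/2], whose square tends
to pi / 4. *)
Lemma cvg_heatF {R : realType} : heatF x%:E @[x --> +oo] --> (1 : R).
Proof.
have cvgI : Num.sqrt (@gauss_integral_proof.integral0_gauss R x ^+ 2) @[x --> +oo]
    --> Num.sqrt (pi / 4).
  apply: continuous_cvg; first exact: sqrt_continuous.
  exact: gauss_integral_proof.cvg_integral0_gauss_sqr.
have cvg_half : s / 2 @[s --> +oo] --> (+oo : set_system R).
  by apply: gt0_cvgMly => //; rewrite ?invr_gt0//; exact: cvg_id.
have sqrtpi_neq0 : Num.sqrt pi != 0 :> R by rewrite gt_eqF// sqrtr_gt0 pi_gt0.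
have lim1 : 2 / Num.sqrt pi * Num.sqrt (pi / 4) = 1 :> R.
  rewrite (_ : 4 = 2 ^+ 2); last by rewrite expr2 -natrM.
  by rewrite sqrtrM ?pi_ge0// sqrtrV// sqrtr_sqr ger0_norm//; field.
rewrite -lim1.
apply: cvg_trans (cvgM (cvg_cst (2 / Num.sqrt pi)) (cvg_comp _ _ cvg_half cvgI)).
apply: near_eq_cvg; near=> x => /=.
have x0 : 0 <= x / 2 by rewrite divr_ge0//; near: x; exact: nbhs_pinfty_ge.
rewrite sqrtr_sqr ger0_norm ?gauss_integral_proof.integral0_gauss_ge0//.
rewrite /gauss_integral_proof.integral0_gauss.
rewrite (Rintegral_FTC2 _ _ _ _ x0 (@continuous_gauss_fun R) is_derive_gauss_cdf).
by rewrite heat_integralE; field.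
Unshelve. all: by end_near. Qed.

Lemma heatF_lt {R : realType} (x y : R) : x < y -> heatF x%:E < heatF y%:E.
Proof.
move=> xy.
have [|c _ ] := @MVT R (fun s => heatF s%:E) heat_density x y xy
  (fun s _ => is_derive_heatF s).
  by apply: derivable_within_continuous => s _; have [] := is_derive_heatF s.
by move=> e; rewrite -subr_gt0 e mulr_gt0 ?heat_density_gt0 ?subr_gt0.
Qed.

Lemma heatF_lt1 {R : realType} (x : R) : heatF x%:E < 1.
Proof.
have /(heatF_lt x)/lt_le_trans : x < x + 1 by rewrite ltrDl.
apply; apply: cvgr_to_ge (cvg_heatF) _; near=> N.
by apply/ltW/heatF_lt; near: N; apply: nbhs_pinfty_gt; exact: num_real.
Unshelve. all: by end_near. Qed.

(* Otherwise simplification replaces F at a finite point by its integral,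
   hiding it from the arithmetic tactics. *)
Local Arguments heatF : simpl never.

(** * A second-derivative test for strict log-concavity *)

Lemma MVT_is_derive {R : realType} (f df : R -> R) (a b : R) : a < b ->
  (forall x : R, a <= x <= b -> is_derive x 1 f (df x)) ->
  exists2 c, a < c < b & f b - f a = df c * (b - a).
Proof.
move=> ab fdf; have [x|z|c] := MVT ab
  (_ : forall x, x \in `]a, b[ -> is_derive x 1 f (df x)).
- by rewrite in_itv /= => /andP[ax xb]; apply: fdf; rewrite !ltW.
- move: z; apply: derivable_within_continuous => x; rewrite in_itv /= => /fdf.
  by case.
- by rewrite in_itv /=; exists c.
Qed.

(** The last condition says that the second derivative
(D D'' - (D')^2) / D^2 of ln D is negative.  The mean value theorem on each
side of t turns the two chord slopes into values of (ln D)' at two points, and a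
third application shows that (ln D)' decreases from one to the other. *)
Lemma ln_strictly_concave {R : realType} (D D1 D2 : R -> R) :
  (forall s : R, 0 <= s <= 1 -> [/\ is_derive s 1 D (D1 s),
     is_derive s 1 D1 (D2 s), 0 < D s & D s * D2 s < D1 s ^+ 2]) ->
  forall t : R, 0 < t < 1 -> t * ln (D 1) + (1 - t) * ln (D 0) < ln (D t).
Proof.
move=> hD t /andP[t0 t1].
have dln (s : R) : 0 <= s <= 1 -> is_derive s 1 (fun x => ln (D x)) (D1 s / D s).
  move=> /hD[dD _ D0 _].
  have := @is_derive1_comp R (@ln R) D s _ _ (is_derive1_ln D0) dD.
  by rewrite mulrC.
have dlog (s : R) : 0 <= s <= 1 -> is_derive s 1 (fun x => D1 x / D x)
    ((D s * D2 s - D1 s ^+ 2) / D s ^+ 2).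
  move=> /hD[dD dD1 D0 _]; have Dn0 : D s != 0 by rewrite gt_eqF.
  have := is_deriveV Dn0 dD => dV.
  have -> : (fun x => D1 x / D x) = D1 * (fun x => (D x)^-1) by [].
  by apply: is_derive_eq; rewrite /GRing.scale /=; field.
have [c1 /andP[c10 c1t] e1] : exists2 c, 0 < c < t &
    ln (D t) - ln (D 0) = D1 c / D c * (t - 0).
  apply: (@MVT_is_derive R (fun x => ln (D x)) (fun x => D1 x / D x)) => // x.
  by move=> /andP[? ?]; apply: dln; lra.
have [c2 /andP[tc2 c21] e2] : exists2 c, t < c < 1 &
    ln (D 1) - ln (D t) = D1 c / D c * (1 - t).
  apply: (@MVT_is_derive R (fun x => ln (D x)) (fun x => D1 x / D x)) => // x.
  by move=> /andP[? ?]; apply: dln; lra.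
have [c /andP[c1c cc2] e] : exists2 c, c1 < c < c2 &
    D1 c2 / D c2 - D1 c1 / D c1 = (D c * D2 c - D1 c ^+ 2) / D c ^+ 2 * (c2 - c1).
  apply: (@MVT_is_derive R (fun x => D1 x / D x)
    (fun s => (D s * D2 s - D1 s ^+ 2) / D s ^+ 2)).
    lra.
  by move=> x /andP[? ?]; apply: dlog; lra.
have slope_lt : D1 c2 / D c2 - D1 c1 / D c1 < 0.
  have [|_ _ Dc0 conc] := hD c; first lra.
  by rewrite e pmulr_llt0 ?ltrBrDr ?pmulr_llt0 ?invr_gt0 ?exprn_gt0//; lra.
rewrite -subr_gt0.
have -> : ln (D t) - (t * ln (D 1) + (1 - t) * ln (D 0)) =
  (1 - t) * (ln (D t) - ln (D 0)) - t * (ln (D 1) - ln (D t)) by ring.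
rewrite e1 e2 (_ : _ - _ = t * (1 - t) * - (D1 c2 / D c2 - D1 c1 / D c1)); last by ring.
by rewrite mulr_gt0 ?oppr_gt0// mulr_gt0// subr_gt0.
Qed.

(** * Mills-type bounds *)

(** The function F(s) + 2 f(s)/s is decreasing: since f'(s) = -(s/2) f(s), its
derivative reduces to -2 f(s)/s^2. *)
Lemma heatF_gap_lt {R : realType} (x y : R) : 0 < y -> y < x ->
  heatF x%:E - heatF y%:E < 2 * heat_density y / y - 2 * heat_density x / x.
Proof.
move=> y0 yx.
have d (s : R) : y <= s <= x -> is_derive s 1
    (fun z => heatF z%:E + 2 * heat_density z / z) (- (2 * heat_density s / s ^+ 2)).
  move=> /andP[ys _]; have s0 : s != 0 by rewrite gt_eqF// (lt_le_trans y0).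
  have dF := is_derive_heatF s; have dg := is_derive_heat_density s.
  have dV := is_deriveV s0 (is_derive_id s 1).
  have -> : (fun z : R => heatF z%:E + 2 * heat_density z / z) =
    (fun z => heatF z%:E) + (2 \*: heat_density) * (fun z => z^-1) by [].
  by apply: is_derive_eq; rewrite /GRing.scale /= /GRing.scale /=; field.
have [c /andP[yc cx] e] := MVT_is_derive _ _ _ _ yx d.
have : 0 < 2 * heat_density c / c ^+ 2 * (x - y).
  have c0 := lt_trans y0 yc.
  by rewrite mulr_gt0 ?subr_gt0// divr_gt0 ?exprn_gt0// mulr_gt0// heat_density_gt0.
lra.
Qed.

(** Letting x tend to +oo in [heatF_gap_lt] loses strictness, so the limit is
taken from y + 1 and the strict bound is kept on [y, y + 1]. *)
Lemma heatF_tail_lt {R : realType} (y : R) : 0 < y ->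
  1 - heatF y%:E < 2 * heat_density y / y.
Proof.
move=> y0.
have tail : 1 <= 2 * heat_density (y + 1) / (y + 1) + heatF (y + 1)%:E.
  apply: cvgr_to_le cvg_heatF _; near=> N.
  have := @heatF_gap_lt R N (y + 1).
  have N0 : y + 1 < N by near: N; apply: nbhs_pinfty_gt; exact: num_real.
  have : 0 < 2 * heat_density N / N.
    have N_gt0 : 0 < N by lra.
    by rewrite divr_gt0// mulr_gt0// heat_density_gt0.
  by move=> pos /(_ ltac:(lra) N0) gap; lra.
by have /(_ ltac:(lra)) := @heatF_gap_lt R (y + 1) y y0; lra.
Unshelve. all: by end_near. Qed.

(** Clearing denominators in [heatF_gap_lt] extends the bound to y = 0, the
inner end of the innermost interval. *)
Lemma heatF_gap_cross {R : realType} (x y : R) : 0 <= y -> y < x ->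
  (heatF x%:E - heatF y%:E) * x * y < 2 * (x * heat_density y - y * heat_density x).
Proof.
rewrite le_eqVlt => /predU1P[<- x0|y0 yx].
  by rewrite mulr0 mul0r subr0 mulr_gt0// mulr_gt0// heat_density_gt0.
have x0 := lt_trans y0 yx; have xy0 := mulr_gt0 x0 y0.
have := heatF_gap_lt _ _ y0 yx; rewrite -(ltr_pM2r xy0) mulrA => /lt_le_trans; apply.
by rewrite le_eqVlt; apply/orP; left; apply/eqP; field; rewrite !gt_eqF.
Qed.

(** * Strict log-concavity of Gaussian masses *)

(** Here p and q stand for the densities at x and y, D for the mass between
them, and h, k for the speeds of x and y; the inequality is the hypothesis of
[ln_strictly_concave].  The difference of its two sides is a quadratic form in
(h, k), positive definite because its h^2 coefficient A and its determinant B
are positive; completing the square makes this explicit. *)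
Lemma gap_quadratic_gt0 {R : realFieldType} (x y p q D h k : R) :
  0 <= y -> y < x -> 0 < p -> 0 < q -> 0 < D ->
  D * x * y < 2 * (x * q - y * p) -> (h, k) != (0, 0) ->
  D * (- (x / 2) * p * h ^+ 2 + y / 2 * q * k ^+ 2) < (p * h - q * k) ^+ 2.
Proof.
move=> y0 yx p0 q0 D0 cross hk; have x0 := le_lt_trans y0 yx.
set A := p ^+ 2 + D * x * p / 2.
have A0 : 0 < A by rewrite addr_gt0 ?exprn_gt0// !mulr_gt0// invr_gt0.
rewrite -subr_gt0 -(pmulr_rgt0 _ A0).
set B := D * p * q / 4 * (2 * (x * q - y * p) - D * x * y).
have B0 : 0 < B by rewrite mulr_gt0 ?subr_gt0// divr_gt0// !mulr_gt0.
have -> : A * ((p * h - q * k) ^+ 2 -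
    D * (- (x / 2) * p * h ^+ 2 + y / 2 * q * k ^+ 2)) =
    (A * h - p * q * k) ^+ 2 + B * k ^+ 2 by rewrite /A /B; field.
have [k0|k0] := eqVneq k 0.
  move: hk; rewrite k0 xpair_eqE eqxx andbT => h0.
  by rewrite expr0n !mulr0 subr0 addr0 lt_def sqr_ge0 sqrf_eq0 mulf_neq0// gt_eqF.
by rewrite ltr_wpDl ?sqr_ge0// mulr_gt0// lt_def sqr_ge0 sqrf_eq0 k0.
Qed.

Lemma is_derive_affine_comp {R : realType} (f : R -> R) (df a b s : R) :
  is_derive (s * a + (1 - s) * b) 1 f df ->
  is_derive s 1 (fun z => f (z * a + (1 - z) * b)) (df * (a - b)).
Proof.
move=> dF; apply: (@is_derive1_comp R f (fun z => z * a + (1 - z) * b)) => //.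
have -> : (fun z : R => z * a + (1 - z) * b) = (a - b) \*: id + cst b.
  by apply/funext => z; rewrite -[RHS]/((a - b) * z + b); ring.
have := is_deriveD (is_deriveZ (a - b) (is_derive_id s 1)) (is_derive_cst b s 1).
by rewrite /GRing.scale /= mulr1 addr0.
Qed.

Lemma convex_comb_gt0 {R : numDomainType} (a b s : R) : 0 <= s <= 1 ->
  0 < a -> 0 < b -> 0 < s * a + (1 - s) * b.
Proof.
move=> /andP[s0 s1] a0 b0; have [->|sn0] := eqVneq s 0.
  by rewrite mul0r add0r subr0 mul1r.
have s_gt0 : 0 < s by rewrite lt_def sn0.
by rewrite ltr_pwDl ?mulr_gt0// mulr_ge0 ?subr_ge0// ltW.
Qed.

(** Along the segment the end points of the interval are affine, with velocities
h and k that do not both vanish, and [heatF_gap_cross] feeds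
[gap_quadratic_gt0]. *)
Lemma ln_heatF_gap_strictly_concave {R : realType} (x1 y1 x0 y0 t : R) :
  0 <= y1 -> y1 < x1 -> 0 <= y0 -> y0 < x0 -> (x1, y1) != (x0, y0) ->
  0 < t < 1 ->
  t * ln (heatF x1%:E - heatF y1%:E) + (1 - t) * ln (heatF x0%:E - heatF y0%:E)
  < ln (heatF (t * x1 + (1 - t) * x0)%:E - heatF (t * y1 + (1 - t) * y0)%:E).
Proof.
move=> y1_ge0 yx1 y0_ge0 yx0 neq t01.
pose X s := s * x1 + (1 - s) * x0; pose Y s := s * y1 + (1 - s) * y0.
pose h := x1 - x0; pose k := y1 - y0.
have hk : (h, k) != (0, 0).
  by apply: contraNneq neq => -[/subr0_eq -> /subr0_eq ->].
have /= := @ln_strictly_concave R (fun s => heatF (X s)%:E - heatF (Y s)%:E)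
  (fun s => heat_density (X s) * h - heat_density (Y s) * k)
  (fun s => - (X s / 2) * heat_density (X s) * h ^+ 2
            + Y s / 2 * heat_density (Y s) * k ^+ 2) _ t t01.
rewrite /X /Y !(mul1r, mul0r, subrr, subr0, addr0, add0r); apply.
move=> s s01; have /andP[s0 s1] := s01; rewrite -/(X s) -/(Y s).
have Y_ge0 : 0 <= Y s by rewrite addr_ge0// mulr_ge0// subr_ge0.
have YX : Y s < X s.
  rewrite -subr_gt0 (_ : X s - Y s = s * (x1 - y1) + (1 - s) * (x0 - y0));
    last by rewrite /X /Y; ring.
  by rewrite convex_comb_gt0// subr_gt0.
split.
- have dX := is_derive_affine_comp _ _ x1 x0 s (is_derive_heatF (X s)).
  have dY := is_derive_affine_comp _ _ y1 y0 s (is_derive_heatF (Y s)).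
  exact: is_deriveB dX dY.
- have dX := is_derive_affine_comp _ _ x1 x0 s (is_derive_heat_density (X s)).
  have dY := is_derive_affine_comp _ _ y1 y0 s (is_derive_heat_density (Y s)).
  have -> : (fun s => heat_density (X s) * h - heat_density (Y s) * k) =
    h \*: (fun s => heat_density (X s)) - k \*: (fun s => heat_density (Y s)).
    by apply/funext => z /=; rewrite mulrC [_ * k]mulrC.
  by apply: is_derive_eq; rewrite /GRing.scale /= -/h -/k; ring.
- by rewrite subr_gt0 heatF_lt.
- apply: gap_quadratic_gt0 => //; rewrite ?heat_density_gt0 ?subr_gt0 ?heatF_lt//.
  exact: heatF_gap_cross.
Qed.

(** The outermost interval has its upper end at +oo, so only y moves and
negativity of the second derivative is exactly [heatF_tail_lt]. *)
Lemma ln_heatF_tail_strictly_concave {R : realType} (y1 y0 t : R) :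
  0 < y1 -> 0 < y0 -> y1 != y0 -> 0 < t < 1 ->
  t * ln (1 - heatF y1%:E) + (1 - t) * ln (1 - heatF y0%:E)
  < ln (1 - heatF (t * y1 + (1 - t) * y0)%:E).
Proof.
move=> y1_gt0 y0_gt0 neq t01.
pose Y s := s * y1 + (1 - s) * y0; pose k := y1 - y0.
have /= := @ln_strictly_concave R (fun s => 1 - heatF (Y s)%:E)
  (fun s => - (heat_density (Y s) * k))
  (fun s => Y s / 2 * heat_density (Y s) * k ^+ 2) _ t t01.
rewrite /Y !(mul1r, mul0r, subrr, subr0, addr0, add0r); apply.
move=> s s01; have /andP[s0 s1] := s01; rewrite -/(Y s).
have Y0 : 0 < Y s by rewrite convex_comb_gt0.
split.
- have dY := is_derive_affine_comp _ _ y1 y0 s (is_derive_heatF (Y s)).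
  have := is_deriveB (is_derive_cst (1 : R) s 1) dY; rewrite sub0r; exact.
- have dY := is_derive_affine_comp _ _ y1 y0 s (is_derive_heat_density (Y s)).
  have -> : (fun s => - (heat_density (Y s) * k)) =
    - (k \*: (fun s => heat_density (Y s))).
    by apply/funext => z /=; rewrite [_ * k]mulrC.
  by apply: is_derive_eq; rewrite /GRing.scale /= -/k; ring.
- by rewrite subr_gt0 heatF_lt1.
- have g0 := @heat_density_gt0 R (Y s).
  have k2 : 0 < heat_density (Y s) * k ^+ 2.
    by rewrite mulr_gt0// lt_def sqr_ge0 sqrf_eq0 subr_eq0 neq.
  have := heatF_tail_lt _ Y0; rewrite ltr_pdivlMr// => tail.
  rewrite [ltLHS](_ : _ = (1 - heatF (Y s)%:E) * Y s / 2 *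
    (heat_density (Y s) * k ^+ 2)); last by ring.
  rewrite sqrrN exprMn [heat_density (Y s) ^+ 2]expr2 -[in ltRHS]mulrA.
  by rewrite ltr_pM2r// ltr_pdivrMr// [ltRHS]mulrC.
Qed.

(** * From intervals to the energy *)

(** The coordinate xi_(j+1), extended by xi_(m+1) = 0, as a real number: the
extended-real encoding is only needed for xi_0. *)
Definition coord {R : realType} {m : nat} (xi : 'rV[R]_m) (j : nat) : R :=
  if insub j is Some o then xi 0 (o : 'I_m) else 0.

Lemma extxiS {R : realType} {m : nat} (xi : 'rV[R]_m) (j : nat) :
  extxi xi j.+1 = (coord xi j)%:E.
Proof. by rewrite /extxi /coord; case: insubP. Qed.

Lemma coord_ord {R : realType} {m : nat} (xi : 'rV[R]_m) (o : 'I_m) :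
  coord xi o = xi 0 o.
Proof. by rewrite /coord valK. Qed.

Lemma coord_comb {R : realType} {m : nat} (x y : 'rV[R]_m) (t s : R) (j : nat) :
  coord (t *: x + s *: y) j = t * coord x j + s * coord y j.
Proof. by rewrite /coord; case: insubP => * ; rewrite ?mxE// !mulr0 addr0. Qed.

Lemma OmegaP {R : realType} {m : nat} (xi : 'rV[R]_m) :
  Omega xi <-> forall j, (j < m)%N -> coord xi j.+1 < coord xi j.
Proof.
split=> [Oxi j jm|dec [|j] // jm].
- by have := Oxi j.+1; rewrite !extxiS lte_fin; exact.
- by rewrite !extxiS lte_fin; exact: dec.
Qed.

Lemma Omega_coord_ge0 {R : realType} {m : nat} (xi : 'rV[R]_m) (j : nat) :
  Omega xi -> 0 <= coord xi j.
Proof.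
move=> /OmegaP dec; have [n] := ubnP (m - j); elim: n j => // n IHn j mj.
have [jm|mj0] := ltnP j m; last by rewrite /coord insubF// ltnNge mj0.
apply: le_trans (ltW (dec j jm)); apply: IHn; rewrite subnS.
by case: (m - j)%N mj (subn_gt0 j m) => [|p]; rewrite ?jm.
Qed.

Definition heat_drop {R : realType} {m : nat} (a : R) (xi : 'rV[R]_m)
    (i : nat) : R :=
  heatF (extxi xi i * (a^-1)%:E)%E - heatF (extxi xi i.+1 * (a^-1)%:E)%E.

Lemma heat_drop0 {R : realType} {m : nat} (a : R) (xi : 'rV[R]_m) : 0 < a ->
  heat_drop a xi 0 = 1 - heatF (coord xi 0 / a)%:E.
Proof. by move=> a0; rewrite /heat_drop extxiS gt0_mulye// lte_fin invr_gt0. Qed.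

Lemma heat_dropS {R : realType} {m : nat} (a : R) (xi : 'rV[R]_m) (j : nat) :
  heat_drop a xi j.+1 = heatF (coord xi j / a)%:E - heatF (coord xi j.+1 / a)%:E.
Proof. by rewrite /heat_drop !extxiS. Qed.

Lemma coord_comb_div {R : realType} {m : nat} (x y : 'rV[R]_m) (t s a : R)
    (j : nat) :
  coord (t *: x + s *: y) j / a = t * (coord x j / a) + s * (coord y j / a).
Proof. by rewrite coord_comb mulrDl -!mulrA. Qed.

Lemma ln_heat_dropS_lt {R : realType} {m : nat} (x y : 'rV[R]_m) (a t : R)
    (j : nat) :
  Omega x -> Omega y -> 0 < a -> 0 < t < 1 -> (j < m)%N ->
  (coord x j, coord x j.+1) != (coord y j, coord y j.+1) ->
  t * ln (heat_drop a x j.+1) + (1 - t) * ln (heat_drop a y j.+1)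
  < ln (heat_drop a (t *: x + (1 - t) *: y) j.+1).
Proof.
move=> Ox Oy a0 t01 jm neq; rewrite !heat_dropS !coord_comb_div.
have ia0 : 0 < a^-1 by rewrite invr_gt0.
apply: ln_heatF_gap_strictly_concave => //.
- by rewrite mulr_ge0 ?Omega_coord_ge0// ltW.
- by rewrite ltr_pM2r//; exact: (OmegaP x).1.
- by rewrite mulr_ge0 ?Omega_coord_ge0// ltW.
- by rewrite ltr_pM2r//; exact: (OmegaP y).1.
- apply: contraNneq neq => -[].
  by move=> /(mulIf (lt0r_neq0 ia0)) -> /(mulIf (lt0r_neq0 ia0)) ->.
Qed.

(** If x and y agree on the coordinates that the layer reads, the layer is
constant along the segment and equality holds; otherwise the strict versions
apply. *)
Lemma ln_heat_drop_le {R : realType} {m : nat} (x y : 'rV[R]_m) (a t : R)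
    (i : nat) :
  Omega x -> Omega y -> 0 < a -> 0 < t < 1 -> (0 < m)%N -> (i <= m)%N ->
  t * ln (heat_drop a x i) + (1 - t) * ln (heat_drop a y i)
  <= ln (heat_drop a (t *: x + (1 - t) *: y) i).
Proof.
move=> Ox Oy a0 t01 m0; have ia0 : 0 < a^-1 by rewrite invr_gt0.
have const (v : R) : t * v + (1 - t) * v = v by ring.
case: i => [_|j jm].
  rewrite !heat_drop0// coord_comb_div.
  have [->|neq] := eqVneq (coord x 0) (coord y 0); first by rewrite !const.
  apply/ltW/ln_heatF_tail_strictly_concave => //.
  - rewrite mulr_gt0// (le_lt_trans (Omega_coord_ge0 x 1 Ox))//.
    exact: (OmegaP x).1.
  - rewrite mulr_gt0// (le_lt_trans (Omega_coord_ge0 y 1 Oy))//.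
    exact: (OmegaP y).1.
  - by apply: contraNneq neq => /(mulIf (lt0r_neq0 ia0)) ->.
have [[e1 e2]|neq] := eqVneq (coord x j, coord x j.+1) (coord y j, coord y j.+1).
  by rewrite !heat_dropS !coord_comb_div e1 e2 !const.
exact/ltW/ln_heat_dropS_lt.
Qed.

Lemma sqr_convex {R : realDomainType} (x y t : R) : 0 <= t <= 1 ->
  (t * x + (1 - t) * y) ^+ 2 <= t * x ^+ 2 + (1 - t) * y ^+ 2.
Proof.
move=> /andP[t0 t1]; rewrite -subr_ge0.
rewrite (_ : _ - _ = t * (1 - t) * (x - y) ^+ 2); last by ring.
by rewrite mulr_ge0 ?sqr_ge0// mulr_ge0// subr_ge0.
Qed.

Lemma ltr_sum_le_lt {R : numDomainType} {I : finType} (i0 : I) (F G : I -> R) :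
  (forall i, F i <= G i) -> F i0 < G i0 -> \sum_i F i < \sum_i G i.
Proof.
move=> FG FG0; rewrite (bigD1 i0)// [ltRHS](bigD1 i0)//=.
by apply: ltr_leD => //; apply: ler_sum => i _; exact: FG.
Qed.

Lemma energyE {R : realType} {m : nat} (u a k d : nat -> R) (xi : 'rV[R]_m) :
  energy u a k d xi =
  - (\sum_(i < m.+1) k i * (u i.+1 - u i) * ln (heat_drop (a i) xi i))
  + \sum_(i < m) d i.+1 * xi 0 i ^+ 2 / 4.
Proof. by []. Qed.

Theorem proposition1p2 (R : realType) (m : nat) (hm : (1 <= m)%N)
    (u a k d : nat -> R)
    (hu0 : u 0%N <= u 1%N)
    (hu : forall i : nat, (1 <= i <= m)%N -> u i < u i.+1)
    (ha : forall i : nat, (i <= m)%N -> 0 < a i)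
    (hk : forall i : nat, (i <= m)%N -> 0 < k i)
    (hd : forall i : nat, (1 <= i <= m)%N -> 0 <= d i)
    (hd1 : u 0%N = u 1%N -> 0 < d 1%N) :
  strictly_convex_function (@Omega R m) (@energy R m u a k d).
Proof.
have comb (x y : 'rV[R]_m) (t : {i01 R}) :
  conv t (x : convex_lmodType 'rV[R]_m) y = t%:num *: x + (1 - t%:num) *: y by [].
have combR (x y : R) (t : {i01 R}) :
  conv t (x : R^o) y = t%:num * x + (1 - t%:num) * y by [].
split.
  move=> x y t /[!inE] /OmegaP decx /OmegaP decy; apply/OmegaP => j jm.
  rewrite comb !coord_comb -subr_gt0.
  rewrite (_ : _ - _ = t%:num * (coord x j - coord x j.+1) +
    (1 - t%:num) * (coord y j - coord y j.+1)); last by ring.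
  by rewrite convex_comb_gt0 ?subr_gt0 ?decx ?decy// ge0 le1.
move=> t t0 t1 x y /[!inE] Ox Oy neq.
have t01 : 0 < t%:num < 1 by rewrite t0.
have [l neql] : exists l, x 0 l != y 0 l.
  apply/existsP; apply: contra_neqT neq => /existsPn same.
  by apply/rowP => i; apply/eqP; have := same i; rewrite negbK.
rewrite comb combR !energyE.
move: (t%:num) t01 {t0 t1 comb combR} => {}t t01; have /andP[/ltW t0 /ltW t1] := t01.
set z := t *: x + _.
pose w i := k i * (u i.+1 - u i).
have w_ge0 (i : 'I_m.+1) : 0 <= w i.
  rewrite mulr_ge0 ?subr_ge0//; first by rewrite ltW// hk// -ltnS.
  by case: i => -[//|i] im /=; exact/ltW/hu.
have layers : t * (\sum_(i < m.+1) w i * ln (heat_drop (a i) x i)) +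
    (1 - t) * (\sum_(i < m.+1) w i * ln (heat_drop (a i) y i))
    < \sum_(i < m.+1) w i * ln (heat_drop (a i) z i).
  rewrite !mulr_sumr -big_split /=.
  under eq_bigr => i _ do rewrite mulrCA [X in _ + X]mulrCA -mulrDr.
  (* The layer l + 1 is the one whose upper end is the coordinate where x and
     y differ. *)
  apply: (ltr_sum_le_lt (lift ord0 l)) => [i|].
    by rewrite ler_wpM2l// ln_heat_drop_le ?ha// -ltnS.
  have w_gt0 : 0 < w l.+1.
    by rewrite mulr_gt0 ?subr_gt0 ?hk ?hu//=.
  rewrite lift0 ltr_pM2l// ln_heat_dropS_lt// ?ha//.
  by rewrite xpair_eqE negb_and !coord_ord neql.
have squares : \sum_(i < m) d i.+1 * z 0 i ^+ 2 / 4 <=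
    t * (\sum_(i < m) d i.+1 * x 0 i ^+ 2 / 4) +
    (1 - t) * (\sum_(i < m) d i.+1 * y 0 i ^+ 2 / 4).
  rewrite !mulr_sumr -big_split /=; apply: ler_sum => i _.
  have -> : t * (d i.+1 * x 0 i ^+ 2 / 4) + (1 - t) * (d i.+1 * y 0 i ^+ 2 / 4)
    = d i.+1 * (t * x 0 i ^+ 2 + (1 - t) * y 0 i ^+ 2) / 4 by ring.
  rewrite ler_pM2r ?invr_gt0// ler_wpM2l ?hd ?ltn_ord//.
  by rewrite !mxE sqr_convex// t0.
move: layers squares; rewrite /w; lra.
Qed.
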